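(* Let $a_3(n)$ be defined by $\sum_{n\geq 0}a_3(n)q^n=\frac{f_3f_6}{f_1f_2}$, where $f_k=\prod_{m\geq1}(1-q^{km})$. Define integers $m_{i,j}$ for $i,j\geq 1$ as follows: $m_{i,j}=0$ whenever $j>i$; $m_{1,1}=3$; $m_{2,1}=2$, $m_{2,2}=3^3$; $m_{3,1}=1$, $m_{3,2}=3^3$, $m_{3,3}=3^5$; and for $i\geq 4$, $m_{i,1}=0$ and for $j\geq 2$, \[m_{i,j}=9m_{i-1,j-1}+3m_{i-2,j-1}+m_{i-3,j-1}.\] Define infinite matrices $A=(a_{i,j})_{i,j\geq1}$ and $B=(b_{i,j})_{i,j\geq1}$ by $a_{i,j}=m_{4i-3,\,i+j-1}$ and $b_{i,j}=m_{4i-1,\,i+j-1}$. Define row vectors $\mathbf{x}_\alpha=(x_{\alpha,1},x_{\alpha,2},\dots)$ by $\mathbf{x}_0=(1,0,0,\dots)$, $\mathbf{x}_{\alpha+1}=\mathbf{x}_\alpha A$ if $\alpha$ is even, and $\mathbf{x}_{\alpha+1}=\mathbf{x}_\alpha B$ if $\alpha$ is odd. Then for each $\alpha\geq 0$, \[\sum_{n\geq0}a_3\left(3^{2\alpha}n+\frac{3^{2\alpha}-1}{4}\right)q^n=\sum_{i\geq1}x_{2\alpha,i}\,q^{i-1}\left(\frac{f_3f_6}{f_1f_2}\right)^{4i-3}\] and \[\sum_{n\geq0}a_3\left(3^{2\alpha+1}n+\frac{3^{2\alpha+2}-1}{4}\right)q^n=\sum_{i\geq1}x_{2\alpha+1,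i}\,q^{i-1}\left(\frac{f_3f_6}{f_1f_2}\right)^{4i-1}.\]
   Context: $a_3(n)$ counts 3-regular cubic partitions of $n$. The vector-matrix products $\mathbf{x}_\alpha A$, $\mathbf{x}_\alpha B$ are finite sums since each $\mathbf{x}_\alpha$ has finitely many nonzero entries. *)

(* Defs.v *)
From HB Require Import structures.
From mathcomp Require Import all_boot all_order all_algebra.
Set Implicit Arguments. Unset Strict Implicit. Unset Printing Implicit Defensive.
Import Order.TTheory GRing.Theory Num.Theory.
Local Open Scope ring_scope.

(* Formal power series over int, represented by their coefficient sequence:
   s n is the coefficient of q^n. *)
Definition series := nat -> int.

Definition smul (f g : series) : series :=
  fun n => \sum_(k < n.+1) f k * g (n - k)%N.

Definition sone : series := fun n => (n == 0%N)%:R.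

Definition sexp (f : series) (e : nat) : series := iter e (smul f) sone.

(* Reciprocal of a series with constant term 1:
   g 0 = 1, g n = - sum_{k=1}^{n} f k * g (n - k). *)
Fixpoint sinv_seq (f : series) (n : nat) : seq int :=
  match n with
  | 0 => [:: 1]
  | n'.+1 => let s := sinv_seq f n' in
             rcons s (- \sum_(1 <= k < n'.+2) f k * nth 0 s (n'.+1 - k)%N)
  end.
Definition sinv (f : series) : series := fun n => nth 0 (sinv_seq f n) n.

(* f_k = prod_{m >= 1} (1 - q^{k m}); its n-th coefficient equals the
   n-th coefficient of the finite product over 1 <= m <= n. *)
Definition fq (k : nat) : series :=
  fun n => (\prod_(m < n) (1 - 'X^(k * m.+1)) : {poly int})`_n.

Definition Fgen : series :=
  smul (smul (fq 3) (fq 6)) (sinv (smul (fq 1) (fq 2))).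

Definition a3 (n : nat) : int := Fgen n.

(* The integers m_{i,j} (i, j >= 1; zero for index 0) *)
Fixpoint mm (i j : nat) {struct i} : int :=
  match i, j with
  | 1, 1 => 3
  | 2, 1 => 2
  | 2, 2 => 27
  | 3, 1 => 1
  | 3, 2 => 27
  | 3, 3 => 243
  | (((i'.+1 as i1).+1 as i2).+1 as i3).+1, j'.+2 =>
      if (i'.+4 < j'.+2)%N then 0
      else 9 * mm i3 j'.+1 + 3 * mm i2 j'.+1 + mm i1 j'.+1
  | _, _ => 0
  end.

Definition Amat (i j : nat) : int := mm (4 * i - 3) (i + j - 1).
Definition Bmat (i j : nat) : int := mm (4 * i - 1) (i + j - 1).

(* x_alpha as a function of the (1-based) index; x_alpha is supported on
   indices 1 <= i <= 3^alpha, so the vector-matrix product is the finite sum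
   over that range. *)
Fixpoint xv (alpha : nat) : nat -> int :=
  match alpha with
  | 0 => fun i => (i == 1%N)%:R
  | a'.+1 => fun j =>
      \sum_(1 <= i < (3 ^ a').+1)
        xv a' i * (if odd a' then Bmat i j else Amat i j)
  end.

(* Main.v *)
Require Import Defs.
From HB Require Import structures.
From mathcomp Require Import all_boot all_order all_algebra.
From mathcomp Require Import boolp ring zify.
Set Implicit Arguments. Unset Strict Implicit. Unset Printing Implicit Defensive.
Import Order.TTheory GRing.Theory Num.Theory.
Local Open Scope ring_scope.

(* Write P = f_1 f_2, F = P(q^3)/P(q) for the generating function, and let U
   extract the coefficients of q^(3n).  By the Jacobi triple product,
   P = phi(-q) psi(q) and the 3-dissections of phi and psi give
     P = a(q^3) - q P(q^9) + q^2 c(q^3)   with   a c = -2 P(q^3)^2.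
   The norm of P from Z[[q]] to Z[[q^3]], computed factor by factor from the
   product P, is P(q^3)^4 / P(q^9); together with the dissection this yields
     F^3 = F(q^3) (1 + 3 q F F(q^3) + 9 q^2 F^2 F(q^3)^2).
   Hence the series F^i U((qF)^i) satisfy the recurrence of the m_{i,j} and
   equal sum_j m_{i,j} (q F^4)^j, so that passing from x_alpha to x_alpha A or
   x_alpha B is exactly the extraction of an arithmetic progression mod 3. *)

(** * The ring of formal power series *)

(* A copy of [series] to carry the ring structure: [nat -> int] itself would
   get the pointwise product. *)
Definition fps : Type := series.

HB.instance Definition _ := gen_eqMixin fps.
HB.instance Definition _ := gen_choiceMixin fps.

Definition trunc (N : nat) (f : series) : {poly int} := \poly_(i < N) f i.

Lemma coef_trunc N f n : (n < N)%N -> (trunc N f)`_n = f n.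
Proof. by move=> nN; rewrite coef_poly nN. Qed.

Lemma coefM_local (p p' r r' : {poly int}) n :
  (forall i, (i <= n)%N -> p`_i = p'`_i) ->
  (forall i, (i <= n)%N -> r`_i = r'`_i) -> (p * r)`_n = (p' * r')`_n.
Proof.
move=> ep er; rewrite !coefM; apply: eq_bigr => i _.
by rewrite ep ?er ?leq_subr // -ltnS.
Qed.

(** Coefficient n of a product involves only coefficients up to n, so the ring laws of series are
    inherited from polynomials. *)
Lemma smul_trunc N f g n : (n < N)%N ->
  smul f g n = (trunc N f * trunc N g)`_n.
Proof.
move=> nN; rewrite coefM; apply: eq_bigr => i _.
have iN : (i < N)%N by rewrite (leq_trans (ltn_ord i)).
by rewrite !coef_trunc // (leq_ltn_trans (leq_subr _ _)).
Qed.

Section FpsRing.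
Implicit Types f g h : fps.

Let add f g : fps := fun n => f n + g n.
Let opp f : fps := fun n => - f n.
Let zero : fps := fun=> 0.

Let addA : associative add.
Proof. by move=> f g h; apply/funext => n; rewrite /add addrA. Qed.
Let addC : commutative add.
Proof. by move=> f g; apply/funext => n; rewrite /add addrC. Qed.
Let add0 : left_id zero add.
Proof. by move=> f; apply/funext => n; rewrite /add add0r. Qed.
Let addN : left_inverse zero opp add.
Proof. by move=> f; apply/funext => n; rewrite /add addNr. Qed.

HB.instance Definition _ := GRing.isZmodule.Build fps addA addC add0 addN.

Let mulC : commutative (smul : fps -> fps -> fps).
Proof.
move=> f g; apply/funext => n.
by rewrite !(@smul_trunc n.+1) // mulrC.
Qed.
Let mulA : associative (smul : fps -> fps -> fps).
Proof.
move=> f g h; apply/funext => n; rewrite !(@smul_trunc n.+1) //.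
transitivity ((trunc n.+1 f * (trunc n.+1 g * trunc n.+1 h))`_n).
  apply: coefM_local => // i le_in.
  by rewrite coef_trunc ?ltnS // (@smul_trunc n.+1).
rewrite mulrA; apply: coefM_local => // i le_in.
by rewrite coef_trunc ?ltnS // (@smul_trunc n.+1).
Qed.
Let mul1 : left_id (sone : fps) smul.
Proof.
move=> f; apply/funext => n; rewrite /smul big_ord_recl big1 => [|i _].
  by rewrite mul1r subn0 addr0.
by rewrite mul0r.
Qed.
Let mulD : left_distributive (smul : fps -> fps -> fps) +%R.
Proof.
move=> f g h; apply/funext => n; rewrite -[RHS]/(smul f h n + smul g h n) /smul -big_split.
by apply: eq_bigr => i _; rewrite mulrDl.
Qed.
Let one_neq0 : (sone : fps) != 0.
Proof. by apply/eqP => /(congr1 (fun f : fps => f 0%N)). Qed.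

HB.instance Definition _ :=
  GRing.Zmodule_isComNzRing.Build fps mulA mulC mul1 mulD one_neq0.
End FpsRing.

Lemma fpsP (f g : fps) : (forall n, f n = g n) <-> f = g.
Proof. by split=> [/funext|->]. Qed.

Lemma fpsD (f g : fps) n : (f + g) n = f n + g n. Proof. by []. Qed.
Lemma fpsN (f : fps) n : (- f) n = - f n. Proof. by []. Qed.
Lemma fpsM (f g : fps) n : (f * g) n = \sum_(k < n.+1) f k * g (n - k)%N.
Proof. by []. Qed.

Lemma fps_sum I (r : seq I) (Q : pred I) (u : I -> fps) n :
  (\sum_(i <- r | Q i) u i) n = \sum_(i <- r | Q i) u i n.
Proof. by elim/big_rec2: _ => // i y1 y2 _ <-. Qed.

Lemma fpsMn (f : fps) k n : (f *+ k) n = f n *+ k.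
Proof. by elim: k => // k IH; rewrite !mulrS fpsD IH. Qed.

Definition qx (a : nat) : fps := fun n => (n == a)%:R.

Lemma qxM a (f : fps) n :
  (qx a * f) n = if (a <= n)%N then f (n - a)%N else 0.
Proof.
rewrite fpsM; case: leqP => an.
  have an1 : (a < n.+1)%N by [].
  rewrite (bigD1 (Ordinal an1)) //= big1 => [|i]; rewrite /qx.
    by rewrite eqxx mul1r addr0.
  by rewrite -val_eqE /= => /negbTE ->; rewrite mul0r.
apply: big1 => i _; rewrite /qx.
have /ltn_eqF -> : (i < a)%N by rewrite (leq_ltn_trans _ an) // -ltnS.
by rewrite mul0r.
Qed.

Lemma qxD a b : qx (a + b) = qx a * qx b.
Proof.
apply/fpsP => n; rewrite qxM /qx.
case: leqP => an; last by rewrite ltn_eqF ?ltn_addr.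
by congr (_%:R); congr nat_of_bool; lia.
Qed.

Lemma qx0 : qx 0 = 1. Proof. by []. Qed.

Lemma qxX a n : qx a ^+ n = qx (a * n).
Proof.
elim: n => [|n IH]; first by rewrite expr0 muln0 qx0.
by rewrite exprS IH mulnS qxD.
Qed.

Lemma qx_inj a (f g : fps) : qx a * f = qx a * g -> f = g.
Proof.
move=> /fpsP e; apply/fpsP => n.
by have := e (n + a)%N; rewrite !qxM leq_addl addnK.
Qed.

(** * Congruence modulo powers of q *)

Definition eqm (N : nat) (f g : fps) := forall n, (n < N)%N -> f n = g n.

Lemma eqm_refl N f : eqm N f f. Proof. by []. Qed.

Lemma eqm_sym N f g : eqm N f g -> eqm N g f.
Proof. by move=> e n nN; rewrite e. Qed.

Lemma eqm_trans N f g h : eqm N f g -> eqm N g h -> eqm N f h.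
Proof. by move=> e1 e2 n nN; rewrite e1 ?e2. Qed.

Lemma eqm_leq {N} M f g : (N <= M)%N -> eqm M f g -> eqm N f g.
Proof. by move=> NM e n nN; rewrite e // (leq_trans nN). Qed.

Lemma eqmP f g : (forall N, eqm N f g) -> f = g.
Proof. by move=> e; apply/fpsP => n; apply: (e n.+1). Qed.

Lemma eqmM N f g f' g' : eqm N f f' -> eqm N g g' -> eqm N (f * g) (f' * g').
Proof.
move=> ef eg n nN; rewrite !fpsM; apply: eq_bigr => i _.
rewrite ef ?eg //; first by rewrite (leq_ltn_trans (leq_subr _ _)).
by rewrite (leq_trans (ltn_ord i)).
Qed.

Lemma eqmD N f g f' g' : eqm N f f' -> eqm N g g' -> eqm N (f + g) (f' + g').
Proof. by move=> ef eg n nN; rewrite !fpsD ef ?eg. Qed.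

Lemma eqmN N f f' : eqm N f f' -> eqm N (- f) (- f').
Proof. by move=> ef n nN; rewrite !fpsN ef. Qed.

Lemma eqm_prod N (I : eqType) (r : seq I) (u v : I -> fps) :
  {in r, forall i, eqm N (u i) (v i)} ->
  eqm N (\prod_(i <- r) u i) (\prod_(i <- r) v i).
Proof.
elim: r => [|i r IH] e; first by rewrite !big_nil.
rewrite !big_cons; apply: eqmM; first by apply: e; rewrite mem_head.
by apply: IH => j jr; apply: e; rewrite in_cons jr orbT.
Qed.

Lemma eqm_qx N a f : (N <= a)%N -> eqm N (qx a * f) 0.
Proof.
move=> Na n nN; rewrite qxM leqNgt (leq_trans nN Na).
by [].
Qed.

Lemma eqm_qx_shift N a f g : eqm N f g -> eqm (a + N) (qx a * f) (qx a * g).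
Proof.
move=> e n nN; rewrite !qxM; case: leqP => // an; apply: e.
by rewrite ltn_subLR.
Qed.

(** * Infinite products and sums *)

(* Tame factors make the infinite product converge q-adically; [dprod] is
   meaningless otherwise.  Likewise for [small] and [dsum]. *)
Definition tame (u : nat -> fps) := forall k, eqm k.+1 (u k) 1.

Definition dprod (u : nat -> fps) : fps := fun n => (\prod_(k < n.+1) u k) n.

(** Coefficient n is read off the first n + 1 factors; every later factor is 1 modulo q^(n+1), so
    longer partial products agree there. *)
Lemma dprod_eqm u N M : tame u -> (N <= M)%N ->
  eqm N (dprod u) (\prod_(k < M) u k).
Proof.
move=> tu NM n nN; rewrite /dprod.
have {NM}nM := leq_trans nN NM.
rewrite -!(big_mkord xpredT u) (@big_cat_nat _ _ _ n.+1 0 M) //=.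
rewrite -[X in X n = _]mulr1; apply: (@eqmM n.+1) => //.
rewrite -[X in eqm _ X _](@big1_seq _ 1 *%R _ (index_iota n.+1 M) xpredT (fun=> 1)) //.
apply: eqm_prod => k; rewrite mem_index_iota => /andP[nk _].
apply: (@eqm_leq _ k.+1); first exact: ltnW.
exact/eqm_sym/tu.
Qed.

(** The means of identifying an infinite product: the number M of factors may be chosen for each
    precision N, which allows regrouping. *)
Lemma eqm_dprod u f : tame u ->
  (forall N, exists2 M, (N <= M)%N & eqm N f (\prod_(k < M) u k)) -> f = dprod u.
Proof.
move=> tu h; apply: eqmP => N; have [M NM e] := h N.
exact: eqm_trans e (eqm_sym (dprod_eqm tu NM)).
Qed.

Lemma dprodM u v : tame u -> tame v ->
  dprod (fun k => u k * v k) = dprod u * dprod v.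
Proof.
move=> tu tv; apply/esym/eqm_dprod => [k|N].
  by rewrite -[1]mulr1; apply: eqmM; [apply: tu | apply: tv].
exists N => //; rewrite big_split; apply: eqmM; exact: dprod_eqm.
Qed.

Lemma tame_sub u s : tame u -> (forall k, k <= s k)%N -> tame (u \o s).
Proof. by move=> tu es k; apply: eqm_leq (tu (s k)); rewrite ltnS. Qed.

Lemma prod_split2 (u : nat -> fps) M :
  \prod_(k < 2 * M) u k = \prod_(k < M) (u (2 * k)%N * u (2 * k).+1).
Proof.
elim: M => [|M IH]; first by rewrite muln0 !big_ord0.
have -> : (2 * M.+1 = (2 * M).+2)%N by lia.
by rewrite !big_ord_recr IH /= mulrA.
Qed.

Lemma prod_split3 (u : nat -> fps) M :
  \prod_(k < 3 * M) u k =
  \prod_(k < M) (u (3 * k)%N * u (3 * k).+1 * u (3 * k).+2).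
Proof.
elim: M => [|M IH]; first by rewrite muln0 !big_ord0.
have -> : (3 * M.+1 = (3 * M).+3)%N by lia.
by rewrite !big_ord_recr IH /= !mulrA.
Qed.

Lemma dprod_split2 u : tame u ->
  dprod u = dprod (fun k => u (2 * k)%N) * dprod (fun k => u (2 * k).+1).
Proof.
move=> tu.
have t0 : tame (fun k => u (2 * k)%N) by apply: (tame_sub (s := muln 2) tu); lia.
have t1 : tame (fun k => u (2 * k).+1)
  by apply: (tame_sub (s := fun k => (2 * k).+1) tu); lia.
rewrite -dprodM //; apply: eqm_dprod => [k|N].
  by rewrite -[1]mulr1; apply: eqmM; [apply: t0|apply: t1].
exists N => //; rewrite -(prod_split2 u); apply: dprod_eqm => //; lia.
Qed.

Lemma dprod_split3 u : tame u ->
  dprod u = dprod (fun k => u (3 * k)%N) * dprod (fun k => u (3 * k).+1)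
          * dprod (fun k => u (3 * k).+2).
Proof.
move=> tu.
have t0 : tame (fun k => u (3 * k)%N) by apply: (tame_sub (s := muln 3) tu); lia.
have t1 : tame (fun k => u (3 * k).+1)
  by apply: (tame_sub (s := fun k => (3 * k).+1) tu); lia.
have t2 : tame (fun k => u (3 * k).+2)
  by apply: (tame_sub (s := fun k => (3 * k).+2) tu); lia.
have t01 : tame (fun k => u (3 * k)%N * u (3 * k).+1).
  by move=> k; rewrite -[1]mulr1; apply: eqmM; [apply: t0|apply: t1].
rewrite -!dprodM //; apply: eqm_dprod => [k|N].
  by rewrite -[1]mulr1; apply: eqmM; [apply: t01|apply: t2].
exists N => //; rewrite -(prod_split3 u); apply: dprod_eqm => //; lia.
Qed.

Definition small (u : nat -> fps) := forall k, eqm k (u k) 0.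

Definition dsum (u : nat -> fps) : fps := fun n => (\sum_(k < n.+1) u k) n.

Lemma dsum_eqm u N M : small u -> (N <= M)%N ->
  eqm N (dsum u) (\sum_(k < M) u k).
Proof.
move=> su NM n nN; rewrite /dsum.
have {NM}nM := leq_trans nN NM.
rewrite -!(big_mkord xpredT u) (@big_cat_nat _ _ _ n.+1 0 M) //= fpsD.
rewrite [X in _ = _ + X]fps_sum [X in _ = _ + X]big1_seq ?addr0 // => k.
by rewrite mem_index_iota => /andP[_ /andP[nk _]]; apply: su.
Qed.

Lemma eqm_dsum u f : small u ->
  (forall N, exists2 M, (N <= M)%N & eqm N f (\sum_(k < M) u k)) -> f = dsum u.
Proof.
move=> su h; apply: eqmP => N; have [M NM e] := h N.
exact: eqm_trans e (eqm_sym (dsum_eqm su NM)).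
Qed.

Lemma dsumD u v : dsum (fun k => u k + v k) = dsum u + dsum v.
Proof. by apply/fpsP => n; rewrite fpsD /dsum big_split. Qed.

Lemma small_qx (g : nat -> fps) (e : nat -> nat) :
  (forall k, k <= e k)%N -> small (fun k => qx (e k) * g k).
Proof. by move=> he k; apply: eqm_qx. Qed.

Lemma dsum_mull f u : small u -> dsum (fun k => f * u k) = f * dsum u.
Proof.
move=> su; apply/esym/eqm_dsum => [k|N].
  by rewrite -(mulr0 f); apply: eqmM.
by exists N => //; rewrite -mulr_sumr; apply: eqmM => //; apply: dsum_eqm.
Qed.

Lemma dsum_recl u : small u -> dsum u = u 0%N + dsum (fun k => u k.+1).
Proof.
move=> su; apply/esym/eqm_dsum => // N; exists N.+1 => //.
rewrite big_ord_recl; apply: eqmD => //.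
by apply: dsum_eqm => // k; apply: eqm_leq (su k.+1).
Qed.

Lemma dsum_split3 u : small u ->
  dsum u = dsum (fun k => u (3 * k)%N) + dsum (fun k => u (3 * k).+1)
          + dsum (fun k => u (3 * k).+2).
Proof.
move=> su; rewrite -!dsumD.
have ssub (s : nat -> nat) : (forall k, k <= s k)%N -> small (u \o s).
  by move=> hs k; apply: eqm_leq (hs k) (su _).
apply: eqm_dsum => [k|N].
  rewrite -[X in eqm _ _ X]addr0 -[X in eqm _ _ (X + _)]addr0.
  by apply: eqmD; first apply: eqmD; apply: eqm_leq (su _); lia.
exists N => //.
have e M : \sum_(k < 3 * M) u k =
  \sum_(k < M) (u (3 * k)%N + u (3 * k).+1 + u (3 * k).+2).
  elim: M => [|M IH]; first by rewrite muln0 !big_ord0.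
  have -> : (3 * M.+1 = (3 * M).+3)%N by lia.
  by rewrite !big_ord_recr IH /= !addrA.
by rewrite -e; apply: dsum_eqm => //; lia.
Qed.

(** * Dissection modulo 3 *)

(** The substitution of q^3 for q. *)
Definition V (f : fps) : fps := fun n => if (3 %| n)%N then f (n %/ 3)%N else 0.

Definition U (s : nat) (f : fps) : fps := fun n => f (3 * n + s)%N.

Lemma UD s f g : U s (f + g) = U s f + U s g. Proof. by []. Qed.
Lemma UMn s f k : U s (f *+ k) = U s f *+ k.
Proof. by elim: k => // k IH; rewrite !mulrS UD IH. Qed.

Lemma U_ext f g : (forall s, (s < 3)%N -> U s f = U s g) -> f = g.
Proof.
move=> e; apply/fpsP => n.
have /fpsP/(_ (n %/ 3)%N) := e (n %% 3)%N (ltn_pmod n (isT : 0 < 3)%N).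
by rewrite /U mulnC -divn_eq.
Qed.

Lemma UV s f : (s < 3)%N -> U s (V f) = if s == 0%N then f else 0.
Proof.
move=> s3; apply/fpsP => n; rewrite /U /V.
case: eqP => [->|s0]; first by rewrite addn0 dvdn_mulr // mulKn.
by rewrite dvdn_addr ?dvdn_mulr // gtnNdvd // lt0n; apply/eqP.
Qed.

(** Series in q^3 act as scalars on the residue classes modulo 3. *)
Lemma U_mulV s f g : (s < 3)%N -> U s (f * V g) = U s f * g.
Proof.
move=> s3; apply/fpsP => n; rewrite /U mulrC [_ * g]mulrC !fpsM.
(* The summand is padded by zeros to 3(n+1) terms, so that the sum falls into blocks of three; [V g]
   leaves one term of each block. *)
pose F k := if (k <= 3 * n + s)%N then V g k * f (3 * n + s - k)%N else 0.
transitivity (\sum_(k < 3 * n.+1) F k).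
  rewrite -(big_mkord xpredT F) (@big_cat_nat _ _ _ (3 * n + s).+1) /=; [|lia..].
  rewrite [X in _ + X]big1_seq ?addr0 => [|k].
    by rewrite big_mkord; apply: eq_bigr => k _; rewrite /F -ltnS ltn_ord.
  rewrite mem_index_iota => /andP[_ /andP[h _]]; rewrite /F leqNgt.
  by rewrite h.
have -> M : \sum_(k < 3 * M) F k = \sum_(k < M) F (3 * k)%N.
  elim: M => [|M IH]; first by rewrite muln0 !big_ord0.
  have -> : (3 * M.+1 = (3 * M).+3)%N by lia.
  rewrite !big_ord_recr IH /=.
  have F_coef0 k : ~~ (3 %| k)%N -> F k = 0.
    by move=> /negbTE h; rewrite /F /V h mul0r; case: ifP.
  by rewrite (F_coef0 (3 * M).+1) ?(F_coef0 (3 * M).+2) ?addr0 //; lia.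
apply: eq_bigr => k _; rewrite /F /V dvdn_mulr // mulKn //.
rewrite ifT; last by have := ltn_ord k; lia.
by congr (_ * f _); have := ltn_ord k; lia.
Qed.

(** Multiplication by q carries class 2 into class 0 of the next block of three, hence the remaining
    factor q. *)
Lemma U0_qx f : U 0 (qx 1 * f) = qx 1 * U 2 f.
Proof.
apply/fpsP => n; rewrite /U !qxM.
have -> : (0 < 3 * n + 0)%N = (0 < n)%N by lia.
by case: ltnP => // n0; congr f; lia.
Qed.

Lemma U1_qx f : U 1 (qx 1 * f) = U 0 f.
Proof. by apply/fpsP => n; rewrite /U qxM addn1 subn1 addn0. Qed.

Lemma U2_qx f : U 2 (qx 1 * f) = U 1 f.
Proof. by apply/fpsP => n; rewrite /U qxM addn2 subn1 addn1. Qed.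

Definition U_qx := (U0_qx, U1_qx, U2_qx).

Lemma VD : {morph V : f g / f + g}.
Proof. by move=> f g; apply/fpsP => n; rewrite fpsD /V; case: ifP; rewrite ?addr0. Qed.
Lemma VN : {morph V : f / - f}.
Proof. by move=> f; apply/fpsP => n; rewrite fpsN /V; case: ifP; rewrite ?oppr0. Qed.

Lemma V_is_zmod_morphism : zmod_morphism V.
Proof. by move=> f g; rewrite VD VN. Qed.

Lemma V_qx a : V (qx a) = qx (3 * a).
Proof.
apply/fpsP => n; rewrite /V /qx; case: ifP => h.
  by congr (_%:R); congr nat_of_bool; lia.
by case: eqP => // e; rewrite e dvdn_mulr in h.
Qed.

Lemma V_is_monoid_morphism : monoid_morphism V.
Proof.
split=> [|f g]; first by rewrite -qx0 V_qx.
by apply: U_ext => s s3; rewrite U_mulV // !UV //; case: eqP => // _; rewrite mul0r.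
Qed.

HB.instance Definition _ := GRing.isZmodMorphism.Build fps fps V V_is_zmod_morphism.
HB.instance Definition _ := GRing.isMonoidMorphism.Build fps fps V V_is_monoid_morphism.

Lemma V_dec f : f = V (U 0 f) + qx 1 * V (U 1 f) + qx 1 ^+ 2 * V (U 2 f).
Proof.
have e s : (s < 3)%N -> U s (V (U 0 f) + qx 1 * V (U 1 f) + qx 1 ^+ 2 * V (U 2 f)) = U s f.
  case: s => [|[|[|//]]] _; rewrite expr2 -mulrA !UD !U_qx !UV //=;
  by rewrite ?mulr0 ?addr0 ?add0r.
by apply: U_ext => s s3; rewrite e.
Qed.

Lemma U_dec a b c :
  let f := V a + qx 1 * V b + qx 1 ^+ 2 * V c in
  [/\ U 0 f = a, U 1 f = b & U 2 f = c].
Proof.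
by split; rewrite /= expr2 -mulrA !UD !U_qx !UV //= ?mulr0 ?addr0 ?add0r.
Qed.

(** * Reciprocals of series with constant term 1 *)

Lemma size_sinv_seq f n : size (sinv_seq f n) = n.+1.
Proof. by elim: n => //= n IH; rewrite size_rcons IH. Qed.

Lemma nth_sinv_seq f n k : (k <= n)%N -> nth 0 (sinv_seq f n) k = sinv f k.
Proof.
elim: n => [|n IH]; first by rewrite leqn0 => /eqP ->.
rewrite leq_eqVlt => /predU1P[-> //|kn].
by rewrite /= nth_rcons size_sinv_seq kn IH.
Qed.

Lemma sinvS f n :
  sinv f n.+1 = - \sum_(1 <= k < n.+2) f k * sinv f (n.+1 - k)%N.
Proof.
rewrite /sinv /= nth_rcons size_sinv_seq ltnn eqxx; congr (- _).
rewrite !big_nat; apply: eq_bigr => k /andP[k0 _].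
by rewrite nth_sinv_seq //; lia.
Qed.

Lemma sinvP (f : fps) : f 0%N = 1 -> f * (sinv f : fps) = 1.
Proof.
move=> f0; apply/fpsP => -[|n]; rewrite fpsM.
  by rewrite big_ord_recl big_ord0 f0 mul1r addr0.
rewrite -(big_mkord xpredT (fun k => f k * sinv f (n.+1 - k)%N)).
by rewrite big_nat_recl // f0 mul1r subn0 sinvS big_add1 /= addNr.
Qed.

Lemma eqm_cancel N (f g h : fps) :
  f 0%N = 1 -> eqm N (f * g) (f * h) -> eqm N g h.
Proof.
move=> f0 e.
have k (u : fps) : (sinv f : fps) * (f * u) = u.
  by rewrite mulrA [_ * f]mulrC sinvP // mul1r.
by rewrite -(k g) -(k h); apply: eqmM.
Qed.

Lemma fps_cancel (f g h : fps) : f 0%N = 1 -> f * g = f * h -> g = h.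
Proof. by move=> f0 e; apply: eqmP => N; apply: (eqm_cancel f0); rewrite e. Qed.

(** * The Jacobi triple product *)

Section QBinomial.
Variables (R : comNzRingType) (Q : R).

(** The Gaussian binomial coefficient, given by its Pascal rule so that no division in [R]
    occurs. *)
Fixpoint qbin (n k : nat) : R :=
  match n, k with
  | _, 0 => 1
  | 0, _.+1 => 0
  | n'.+1, k'.+1 => qbin n' k' + Q ^+ k * qbin n' k
  end.

Definition qpoch (n : nat) : R := \prod_(i < n) (1 - Q ^+ i.+1).

Lemma qpochS n : qpoch n.+1 = qpoch n * (1 - Q ^+ n.+1).
Proof. exact: big_ord_recr. Qed.

Lemma qbinn0 n : qbin n 0 = 1. Proof. by case: n. Qed.

Lemma qbin_small n k : (n < k)%N -> qbin n k = 0.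
Proof.
elim: n k => [|n IH] [|k] //= nk.
by rewrite !IH ?mulr0 ?addr0 // ltnW.
Qed.

(** Induction on n: splitting off the factor i = 0 leaves the product for x Q. The homogeneous form
    in x and y avoids the negative powers of Q of the usual derivation of the triple product. *)
Lemma qbinomial n (x y : R) :
  \prod_(i < n) (y + x * Q ^+ i) =
  \sum_(k < n.+1) Q ^+ 'C(k, 2) * qbin n k * x ^+ k * y ^+ (n - k).
Proof.
elim: n x => [|n IH] x.
  by rewrite big_ord0 big_ord_recl big_ord0 !expr0 !mul1r addr0.
rewrite big_ord_recl expr0 mulr1.
under eq_bigr => i _ do rewrite /= exprS mulrA.
rewrite IH mulrDl.
(* The vanishing term k = n + 1 is added so that both contributions to the Pascal rule range over
   the same indices. *)
have -> : y * \sum_(k < n.+1) Q ^+ 'C(k, 2) * qbin n k * (x * Q) ^+ k * y ^+ (n - k)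
  = y * \sum_(k < n.+2) Q ^+ 'C(k, 2) * qbin n k * (x * Q) ^+ k * y ^+ (n - k).
  by rewrite [in RHS]big_ord_recr /= (@qbin_small n n.+1) // mulr0 !mul0r addr0.
rewrite big_ord_recl [in RHS]big_ord_recl mulrDr -addrA; congr (_ + _).
  by rewrite /= !qbinn0 !expr0 !mulr1 !subn0 exprS; ring.
rewrite !mulr_sumr -big_split; apply: eq_bigr => k _ /=.
rewrite /bump /= add1n binS bin1 subSS mulrDr !mulrDl addrC.
rewrite !exprMn !exprD; congr (_ + _); first by rewrite !exprS; ring.
have [kn|kn] := ltnP k n; last by rewrite (@qbin_small n k.+1) // !(mulr0, mul0r).
have -> : (n - k = (n - k.+1).+1)%N by lia.
by rewrite !exprS; ring.
Qed.

Lemma qbin_fact n k : (k <= n)%N ->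
  qbin n k * qpoch k * qpoch (n - k) = qpoch n.
Proof.
elim: n k => [|n IH] [|k] //= kn; rewrite ?qbinn0 ?subn0.
- by rewrite /qpoch !big_ord0 !mulr1.
- by rewrite /qpoch big_ord0 !mul1r.
rewrite subSS mulrDl mulrDl; move: kn; rewrite ltnS leq_eqVlt => /predU1P[->|kn].
  by rewrite subnn (@qbin_small n n.+1) // mulr0 !mul0r addr0 qpochS mulrA
     -{2}(IH n) // subnn /qpoch big_ord0; ring.
have e : (n - k = (n - k.+1).+1)%N by lia.
have IH1 := IH k (ltnW kn); have IH2 := IH _ kn.
have e1 : qpoch (n - k) = qpoch (n - k.+1) * (1 - Q ^+ (n - k)).
  by rewrite e qpochS.
rewrite e1 in IH1 *.
rewrite [qpoch k.+1]qpochS in IH2 *.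
rewrite [qpoch n.+1]qpochS.
transitivity (qpoch n * (1 - Q ^+ k.+1) + Q ^+ k.+1 * qpoch n * (1 - Q ^+ (n - k))).
  by rewrite -{1}IH1 -IH2; ring.
have -> : (n.+1 = k.+1 + (n - k))%N by lia.
by rewrite exprD; ring.
Qed.
End QBinomial.

Definition eprod (e : fps) (c r : nat) : fps :=
  dprod (fun k => 1 + e * qx (c * k + r)).

(* With [e = 1] or [e = -1], the terms [n >= 0] of the two-sided theta series
   [sum_n e^n q^(c n(n-1)/2 + r n)]; the terms [n <= 0] form [htheta e c (c - r)]. *)
Definition htheta (e : fps) (c r : nat) : fps :=
  dsum (fun n => qx (c * 'C(n, 2) + r * n) * e ^+ n).

Lemma eqm_1D N a f : (N <= a)%N -> eqm N (1 + f * qx a) 1.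
Proof.
move=> Na; rewrite -[X in eqm _ _ X]addr0; apply: eqmD => //.
by rewrite mulrC; apply: eqm_qx.
Qed.

Lemma tame_eprod e c r : (0 < c)%N -> (0 < r)%N ->
  tame (fun k => 1 + e * qx (c * k + r)).
Proof. by move=> c0 r0 k; apply: eqm_1D; nia. Qed.

Lemma small_htheta e c r : (0 < r)%N ->
  small (fun n => qx (c * 'C(n, 2) + r * n) * e ^+ n).
Proof. by move=> r0; apply: small_qx => k; nia. Qed.

Lemma qpoch_eqm c M N : (0 < c)%N -> (N <= M)%N ->
  eqm N.+1 (qpoch (qx c) M) (qpoch (qx c) N).
Proof.
move=> c0; elim: M => [|M IH]; first by rewrite leqn0 => /eqP ->.
rewrite leq_eqVlt => /predU1P[-> //|NM].
rewrite qpochS -[qpoch (qx c) N]mulr1; apply: eqmM; first exact: IH.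
by rewrite qxX -[qx _]mul1r -mulNr; apply: eqm_1D; nia.
Qed.

Lemma qpoch_qx0 c n : (0 < c)%N -> qpoch (qx c) n 0%N = 1.
Proof.
by move=> c0; rewrite (qpoch_eqm (N := 0) c0) // /qpoch big_ord0.
Qed.

(** By [qbin_fact], the binomial times the q-factorials of N + n and N - n is that of 2N. Modulo
    q^(N-n+1) all these q-factorials agree with that of N - n, which has constant term 1 and
    cancels. *)
Lemma qbin_eqm c N n k : (0 < c)%N -> (n <= N)%N ->
  (k = N + n \/ k = N - n)%N ->
  eqm (N - n).+1 (qpoch (qx c) N * qbin (qx c) (2 * N) k) 1.
Proof.
move=> c0 nN hk.
apply: (@eqm_cancel _ (qpoch (qx c) (N - n))); first exact: qpoch_qx0.
have kN : (k <= 2 * N)%N by lia.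
have e : qpoch (qx c) k * qpoch (qx c) (2 * N - k) =
    qpoch (qx c) (N + n) * qpoch (qx c) (N - n).
  case: hk => ->; first by congr (_ * qpoch _ _); lia.
  by rewrite mulrC; congr (qpoch _ _ * _); lia.
have f := qbin_fact (qx c) kN.
rewrite mulr1.
apply: (@eqm_trans _ _
  (qpoch (qx c) (N - n) * (qpoch (qx c) (N + n) * qbin (qx c) (2 * N) k))).
  do 2![apply: eqmM => //].
  apply: eqm_trans (qpoch_eqm c0 (leq_subr n N)) (eqm_sym _).
  by apply: qpoch_eqm => //; lia.
have -> : qpoch (qx c) (N - n) * (qpoch (qx c) (N + n) * qbin (qx c) (2 * N) k)
  = qpoch (qx c) (2 * N) by rewrite -f -mulrA e; ring.
by apply: qpoch_eqm => //; lia.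
Qed.

(** The left side is the exponent of Q in the term k = N + n of [qbinomial] with 2N factors and y =
    Q^N; it exceeds its value at n = 0 by the theta exponent C(n,2). *)
Lemma bin2_addC N n : (n <= N)%N ->
  ('C(N + n, 2) + N * (N - n) = 'C(N, 2) + N * N + 'C(n, 2))%N.
Proof.
elim: n => [|n IH] nN; first by rewrite bin0n addn0 subn0; lia.
by have := IH (ltnW nN); rewrite addnS !binS !bin1; nia.
Qed.

Lemma bin2_subC N n : (n <= N)%N ->
  ('C(N - n, 2) + N * (N + n) = 'C(N, 2) + N * N + 'C(n, 2) + n)%N.
Proof.
elim: n => [|n IH] nN; first by rewrite bin0n subn0; lia.
have := IH (ltnW nN).
have -> : (N - n = (N - n.+1).+1)%N by lia.
by rewrite !binS !bin1; nia.
Qed.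

Section JacobiTripleProduct.
Variables (e : fps) (c r : nat).
Hypotheses (e2 : e * e = 1) (r_gt0 : (0 < r)%N) (rc : (r < c)%N).

Let c_gt0 : (0 < c)%N. Proof. exact: ltn_trans rc. Qed.
Let Q := qx c.
Let A N := \prod_(k < N) (1 + e * qx (c * k + r)).
Let B N := \prod_(k < N) (1 + e * qx (c * k + (c - r))).
Let D N := (c * ('C(N, 2) + N * N) + r * N)%N.

(** The factors with i >= N are Q^N times those of [A N]; those with i < N, read backwards, are
    monomials times the factors of [B N]. Here e is its own inverse. *)
Let prod_side N : \prod_(i < 2 * N) (Q ^+ N + (e * qx r) * Q ^+ i) =
  e ^+ N * qx (D N) * (A N * B N).
Proof.
have -> : (2 * N = N + N)%N by lia.
rewrite big_split_ord /=.
have -> : \prod_(i < N) (Q ^+ N + e * qx r * Q ^+ (N + i)) =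
    Q ^+ (N * N) * A N.
  rewrite exprM -[X in _ ^+ X * _](card_ord N) -prodr_const -big_split.
  by apply: eq_bigr => i _ /=; rewrite exprD [qx (_ + _)]qxD -(qxX c i); rewrite -/Q; ring.
have -> : \prod_(i < N) (Q ^+ N + e * qx r * Q ^+ i) =
    (\prod_(i < N) (e * qx r * Q ^+ i)) * B N.
  rewrite [B N](reindex_inj rev_ord_inj) -big_split.
  apply: eq_bigr => i _ /=.
  have iN := ltn_ord i.
  rewrite mulrDr mulr1 addrC; congr (_ + _).
  transitivity (e * e * (qx r * Q ^+ i * qx (c * (N - i.+1) + (c - r)))).
    by rewrite e2 mul1r !qxX -!qxD; congr qx; nia.
  by ring.
have -> : \prod_(i < N) (e * qx r * Q ^+ i) = e ^+ N * qx (r * N) * Q ^+ 'C(N, 2).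
  rewrite big_split prodr_const card_ord exprMn qxX; congr (_ * _).
  by elim: N => [|N IH]; rewrite ?big_ord0 // big_ord_recr IH binS bin1 exprD.
rewrite /D !qxX qxD [(c * (_ + _))%N]mulnDr qxD; ring.
Qed.

(* The q-binomial theorem for [2N] factors, divided by the monomial [D N]. *)
Lemma jtp_finite N :
  A N * B N =
  \sum_(n < N.+1) qx (c * 'C(n, 2) + r * n) * e ^+ n * qbin Q (2 * N) (N + n)
  + \sum_(n < N) qx (c * 'C(n.+1, 2) + (c - r) * n.+1) * e ^+ n.+1
                  * qbin Q (2 * N) (N - n.+1).
Proof.
apply: (@qx_inj (D N)).
have eN : e ^+ N * e ^+ N = 1 by rewrite -exprMn e2 expr1n.
have := prod_side N; rewrite qbinomial => /(congr1 (fun f => e ^+ N * f)).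
rewrite 3!mulrA eN mul1r -mulrA => <-.
have -> : ((2 * N).+1 = N + N.+1)%N by lia.
rewrite big_split_ord /= mulrDr mulrDr addrC !mulr_sumr; congr (_ + _).
  apply: eq_bigr => n _ /=; have nN : (n <= N)%N by rewrite -ltnS.
  rewrite exprMn -exprM !qxX.
  transitivity (e ^+ N * e ^+ (N + n) *
    (qx (c * ('C(N + n, 2) + N * (N - n)) + r * (N + n)) * qbin Q (2 * N) (N + n))).
    have -> : (2 * N - (N + n) = N - n)%N by lia.
    by rewrite qxD (mulnDr c) mulnA qxD; ring.
  have -> : e ^+ N * e ^+ (N + n) = e ^+ n by rewrite exprD mulrA eN mul1r.
  by rewrite bin2_addC // /D !mulnDr !qxD; ring.
rewrite (reindex_inj rev_ord_inj); apply: eq_bigr => n _ /=.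
have nN := ltn_ord n; rewrite exprMn -exprM !qxX.
set m := n.+1 in nN *.
have eNm : e ^+ N * e ^+ (N - m) = e ^+ m.
  rewrite -{1}(subnK nN) exprD mulrAC -exprMn e2 expr1n mul1r.
  by [].
transitivity (e ^+ N * e ^+ (N - m) *
    (qx (c * ('C(N - m, 2) + N * (N + m)) + r * (N - m)) * qbin Q (2 * N) (N - m))).
  have -> : (2 * N - (N - m) = N + m)%N by lia.
  by rewrite qxD (mulnDr c) mulnA qxD; ring.
rewrite eNm bin2_subC //.
have -> : (c * ('C(N, 2) + N * N + 'C(m, 2) + m) + r * (N - m) =
  D N + (c * 'C(m, 2) + (c - r) * m))%N by rewrite /D; nia.
by rewrite qxD; ring.
Qed.

(** The limit of [jtp_finite] multiplied by the q-factorial of N in base q^c, taken modulo each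
    q^N. *)
Theorem jacobi_triple_product :
  eprod e c r * eprod e c (c - r) * eprod (-1) c c = htheta e c r + htheta e c (c - r) - 1.
Proof.
have cr0 : (0 < c - r)%N by rewrite subn_gt0.
apply: eqmP => N.
have EC : eqm N (eprod (-1) c c) (qpoch Q N).
  apply: eqm_trans (dprod_eqm (tame_eprod _ c_gt0 c_gt0) (leqnn N)) _.
  suff -> : \prod_(k < N) (1 + -1 * qx (c * k + c)) = qpoch Q N by [].
  by apply: eq_bigr => k _; rewrite qxX mulnS addnC mulN1r.
have EA : eqm N (eprod e c r) (A N) := dprod_eqm (tame_eprod _ c_gt0 r_gt0) (leqnn N).
have EB : eqm N (eprod e c (c - r)) (B N) :=
  dprod_eqm (tame_eprod _ c_gt0 cr0) (leqnn N).
apply: eqm_trans (eqmM (eqmM EA EB) EC) _.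
rewrite jtp_finite mulrC mulrDr !mulr_sumr.
(* The subtracted 1 is the term n = 0, common to both halves. *)
have -> : htheta e c r + htheta e c (c - r) - 1 = htheta e c r +
    dsum (fun n => qx (c * 'C(n.+1, 2) + (c - r) * n.+1) * e ^+ n.+1).
  rewrite [htheta e c (c - r)]dsum_recl; last exact: small_htheta.
  by rewrite bin0n !muln0 qx0; ring.
(* The binomial factor is 1 only modulo q^(N-n+1); the monomial in front has exponent at least n
   because s > 0, which restores the precision. *)
have term s n k : (0 < s)%N -> (n <= N)%N -> (k = N + n \/ k = N - n)%N ->
    eqm N (qpoch Q N * (qx (c * 'C(n, 2) + s * n) * e ^+ n * qbin Q (2 * N) k))
          (qx (c * 'C(n, 2) + s * n) * e ^+ n).
  move=> s0 nN hk; set x := (_ + _)%N.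
  have -> : qpoch Q N * (qx x * e ^+ n * qbin Q (2 * N) k) =
     qx x * (e ^+ n * (qpoch Q N * qbin Q (2 * N) k)) by ring.
  apply: (@eqm_leq _ (x + (N - n).+1)); first by rewrite /x; nia.
  apply: eqm_qx_shift; rewrite -[X in eqm _ _ X]mulr1; apply: eqmM => //.
  exact: (@qbin_eqm c N n k).
apply: eqmD.
  apply: (@eqm_trans _ _ (\sum_(n < N.+1) qx (c * 'C(n, 2) + r * n) * e ^+ n)).
    move=> i iN; rewrite !fps_sum; apply: eq_bigr => n _.
    by apply: term => //; [rewrite -ltnS | left].
  by apply: eqm_sym; apply: dsum_eqm => //; apply: small_htheta.
apply: (@eqm_trans _ _ (\sum_(n < N) qx (c * 'C(n.+1, 2) + (c - r) * n.+1) * e ^+ n.+1)).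
  move=> i iN; rewrite !fps_sum; apply: eq_bigr => n _.
  by apply: term => //; right.
apply: eqm_sym; apply: dsum_eqm => // k.
by apply: eqm_leq (small_htheta e c cr0 (k := k.+1)).
Qed.
End JacobiTripleProduct.

(** * Splitting and rescaling of infinite products and theta series *)

Lemma V1 : V 1 = 1. Proof. exact: rmorph1. Qed.
Lemma VM : {morph V : f g / f * g}. Proof. exact: rmorphM. Qed.
Lemma VX n : {morph V : f / f ^+ n}. Proof. exact: rmorphXn. Qed.
Lemma VB : {morph V : f g / f - g}. Proof. exact: rmorphB. Qed.

Lemma dsum_split2 u : small u ->
  dsum u = dsum (fun k => u (2 * k)%N) + dsum (fun k => u (2 * k).+1).
Proof.
move=> su; rewrite -!dsumD; apply: eqm_dsum => [k|N].
  rewrite -[X in eqm _ _ X]addr0.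
  by apply: eqmD; apply: eqm_leq (su _); lia.
exists N => //.
have e M : \sum_(k < 2 * M) u k =
  \sum_(k < M) (u (2 * k)%N + u (2 * k).+1).
  elim: M => [|M IH]; first by rewrite muln0 !big_ord0.
  have -> : (2 * M.+1 = (2 * M).+2)%N by lia.
  by rewrite !big_ord_recr IH /= !addrA.
by rewrite -e; apply: dsum_eqm => //; lia.
Qed.

Lemma eq_dprod u v : u =1 v -> dprod u = dprod v.
Proof. by move=> e; congr dprod; apply/funext. Qed.

Lemma eq_dsum u v : u =1 v -> dsum u = dsum v.
Proof. by move=> e; congr dsum; apply/funext. Qed.

Lemma eprod_split2 e c r : (0 < c)%N -> (0 < r)%N ->
  eprod e c r = eprod e (2 * c) r * eprod e (2 * c) (c + r).
Proof.
move=> c0 r0; rewrite /eprod dprod_split2; last exact: tame_eprod.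
congr (_ * _); apply: eq_dprod => k; congr (1 + e * qx _); lia.
Qed.

Lemma eprod_split3 e c r : (0 < c)%N -> (0 < r)%N ->
  eprod e c r = eprod e (3 * c) r * eprod e (3 * c) (c + r) * eprod e (3 * c) (2 * c + r).
Proof.
move=> c0 r0; rewrite /eprod dprod_split3; last exact: tame_eprod.
congr (_ * _ * _); apply: eq_dprod => k; congr (1 + e * qx _); lia.
Qed.

(** Factorwise, (1 - x)(1 + x) = 1 - x^2. *)
Lemma eprod_conj c r : (0 < c)%N -> (0 < r)%N ->
  eprod (-1) c r * eprod 1 c r = eprod (-1) (2 * c) (2 * r).
Proof.
move=> c0 r0; rewrite /eprod -dprodM; [|exact: tame_eprod..].
apply: eq_dprod => k.
have -> : (2 * c * k + 2 * r = (c * k + r) + (c * k + r))%N by lia.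
by rewrite (qxD (c * k + r)); ring.
Qed.

Lemma V_eqm N f g : eqm N f g -> eqm N (V f) (V g).
Proof.
by move=> e n nN; rewrite /V; case: ifP => // _; apply: e; lia.
Qed.

Lemma V_eprod e c r : V e = e -> (0 < c)%N -> (0 < r)%N ->
  V (eprod e c r) = eprod e (3 * c) (3 * r).
Proof.
move=> Ve c0 r0; apply: eqm_dprod => [|N]; first by apply: tame_eprod; lia.
exists N => //; have := V_eqm (dprod_eqm (tame_eprod e c0 r0) (leqnn N)).
rewrite rmorph_prod /= => h; apply: eqm_trans h _.
have -> // : \prod_(k < N) V (1 + e * qx (c * k + r)) =
        \prod_(k < N) (1 + e * qx (3 * c * k + 3 * r)).
apply: eq_bigr => k _; rewrite VD V1 VM V_qx Ve.
by congr (1 + e * qx _); lia.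
Qed.

Lemma V_htheta e c r : V e = e -> (0 < r)%N -> V (htheta e c r) = htheta e (3 * c) (3 * r).
Proof.
move=> Ve r0; apply: eqm_dsum => [|N]; first by apply: small_htheta; lia.
exists N => //; have := V_eqm (dsum_eqm (small_htheta e c r0) (leqnn N)).
rewrite rmorph_sum /= => h; apply: eqm_trans h _.
have -> // : \sum_(k < N) V (qx (c * 'C(k, 2) + r * k) * e ^+ k) =
        \sum_(k < N) (qx (3 * c * 'C(k, 2) + 3 * r * k) * e ^+ k).
apply: eq_bigr => k _; rewrite VM VX V_qx Ve.
by congr (qx _ * _); lia.
Qed.

Lemma eprod_coef0 e c r : (0 < c)%N -> (0 < r)%N -> eprod e c r 0%N = 1.
Proof.
by move=> c0 r0; rewrite /eprod /dprod big_ord1 (@tame_eprod e c r).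
Qed.

Lemma fq_eprod k : (0 < k)%N -> fq k = eprod (-1) k k.
Proof.
(* [dprod] reads coefficient n off n + 1 factors, [fq] off n of them; the extra factor is 1 modulo
   q^(n+1). *)
move=> k0; apply/fpsP => n; rewrite /eprod /dprod big_ord_recr /=.
pose pf (p : {poly int}) : fps := fun n => p`_n.
have pfM p r : pf (p * r) = pf p * pf r by apply/fpsP => i; rewrite /pf coefM.
have pf1 : pf 1 = 1 by apply/fpsP => i; rewrite /pf coef1.
have -> : fq k n = (\prod_(m < n) pf (1 - 'X^(k * m.+1))) n.
  by rewrite -(big_morph pf pfM pf1).
rewrite -[LHS]/((_ : fps) n) -[X in X n]mulr1.
have -> : \prod_(m < n) pf (1 - 'X^(k * m.+1)) = \prod_(i < n) (1 + -1 * qx (k * i + k)).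
  apply: eq_bigr => i _; apply/fpsP => j.
  by rewrite /pf coefB coef1 coefXn mulN1r fpsD fpsN /qx mulnS addnC.
by apply: (@eqmM n.+1) => //; apply: eqm_sym; apply: eqm_1D; nia.
Qed.

Lemma htheta_recl e c r : (0 < r)%N -> htheta e c r =
  1 + dsum (fun k => qx (c * 'C(k.+1, 2) + r * k.+1) * e ^+ k.+1).
Proof.
by move=> r0; rewrite /htheta dsum_recl ?bin0n ?muln0 ?qx0 ?mulr1 //; apply: small_htheta.
Qed.

(** * Theta functions and the 3-dissection of f_1 f_2 *)

Lemma bin2_double n : (2 * 'C(n, 2) + n = n * n)%N.
Proof. by elim: n => // n; rewrite binS bin1; nia. Qed.

(* [phi(-q)], [psi(q)] in Ramanujan's notation, and the series that occur in
   their 3-dissections. *)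
Definition phi : fps := htheta (-1) 2 1 + htheta (-1) 2 1 - 1.
Definition psi : fps := htheta 1 4 1 + htheta 1 4 3 - 1.
Definition Omega : fps := htheta (-1) 6 1 + htheta (-1) 6 5 - 1.
Definition Afq : fps := htheta 1 3 1 + htheta 1 3 2 - 1.

Lemma VN1 : V (-1) = -1. Proof. by rewrite VN V1. Qed.

Lemma sign_add2 n m : (-1 : fps) ^+ (n + n + m) = (-1) ^+ m.
Proof. by rewrite !exprD -exprMn mulrNN mulr1 expr1n mul1r. Qed.

(** The exponents are squares, sorted by n modulo 3: n = 3k gives phi(-q^9), while n = 3k+1 and n =
    3k+2 give the two halves of [Omega]. *)
Lemma phi_dissection : phi = V (V phi) - 2 * qx 1 * V Omega.
Proof.
(* The two halves of [phi] coincide, so one of them suffices. *)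
suff e : htheta (-1) 2 1 = V (V (htheta (-1) 2 1)) - qx 1 * V Omega.
  rewrite {1}/phi {1 2}e !VB !VD !V1; ring.
have e0 : dsum (fun k => qx (2 * 'C(3 * k, 2) + 1 * (3 * k)) * (-1) ^+ (3 * k))
    = htheta (-1) 18 9.
  apply: eq_dsum => k; congr (qx _ * _).
    by have := bin2_double (3 * k); have := bin2_double k; nia.
  have -> : (3 * k = k + k + k)%N by lia.
  exact: sign_add2.
have e1 : dsum (fun k => qx (2 * 'C((3 * k).+1, 2) + 1 * (3 * k).+1) * (-1) ^+ (3 * k).+1)
    = - qx 1 * htheta (-1) 18 15.
  rewrite -dsum_mull; last by apply: small_htheta.
  apply: eq_dsum => k; rewrite mulrA mulNr -qxD exprS.
  have -> : (3 * k = k + k + k)%N by lia.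
  rewrite sign_add2 mulN1r mulrN mulNr; congr (- (qx _ * _)).
  by have := bin2_double (k + k + k).+1; have := bin2_double k; nia.
have e2 : dsum (fun k => qx (2 * 'C((3 * k).+2, 2) + 1 * (3 * k).+2) * (-1) ^+ (3 * k).+2)
    = - qx 1 * (htheta (-1) 18 3 - 1).
  rewrite htheta_recl // addrAC subrr add0r -dsum_mull; last first.
    by move=> k; apply: eqm_leq (small_htheta (-1) 18 (isT : 0 < 3)%N (k := k.+1)).
  apply: eq_dsum => k; rewrite mulrA mulNr -qxD.
  have -> : ((3 * k).+2 = k.+1 + k.+1 + k)%N by lia.
  rewrite sign_add2 exprS mulN1r mulrN mulNr opprK; congr (qx _ * _).
  by have := bin2_double (k.+1 + k.+1 + k); have := bin2_double k.+1; nia.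
rewrite {1}/htheta dsum_split3; last by apply: small_htheta.
rewrite e0 e1 e2 /Omega !VB !VD !V1 !V_htheta ?VN1 //.
by ring.
Qed.

(** The two halves of [psi] are the triangular numbers of even and of odd index. *)
Lemma psi_htheta : psi = htheta 1 1 1.
Proof.
rewrite {1}/htheta dsum_split2; last exact: small_htheta.
rewrite /psi [htheta 1 4 1]htheta_recl // addrAC [1 + _]addrC addrK addrC.
congr (_ + _); apply: eq_dsum => k; rewrite !expr1n; congr (qx _ * _).
  by have := bin2_double (2 * k); have := bin2_double k; nia.
by have := bin2_double (2 * k).+1; have := bin2_double k.+1; nia.
Qed.

(** The triangular number of index 3k+1 is 1 plus 9 times that of index k; the indices 3k and 3k+2
    give 3 times the generalized pentagonal numbers, the exponents of [Afq]. *)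
Lemma psi_dissection : psi = V Afq + qx 1 * V (V psi).
Proof.
rewrite psi_htheta {1}/htheta dsum_split3; last exact: small_htheta.
rewrite /Afq !VB !VD !V1 !V_htheta ?V1 // [htheta 1 (3 * 3) (3 * 1)]htheta_recl //.
have -> : forall a b c : fps, 1 + a + b - 1 + c = b + c + a by move=> *; ring.
rewrite -dsum_mull; last exact: small_htheta.
congr (_ + _ + _); apply: eq_dsum => k; rewrite !expr1n !mulr1 -?qxD; congr qx.
- by have := bin2_double (3 * k); have := bin2_double k; nia.
- by have := bin2_double (3 * k).+1; have := bin2_double k; nia.
- by have := bin2_double (3 * k).+2; have := bin2_double k.+1; nia.
Qed.

Definition P : fps := eprod (-1) 1 1 * eprod (-1) 2 2.

Lemma P_eq_phi_psi : P = phi * psi.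
Proof.
have -> : phi = eprod (-1) 2 1 * eprod (-1) 2 1 * eprod (-1) 2 2.
  by apply/esym/(@jacobi_triple_product (-1) 2 1); rewrite // mulrNN mulr1.
have -> : psi = eprod 1 4 1 * eprod 1 4 3 * eprod (-1) 4 4.
  by apply/esym/(@jacobi_triple_product 1 4 1); rewrite // mulr1.
have -> : eprod 1 4 1 * eprod 1 4 3 = eprod 1 2 1 by rewrite [RHS]eprod_split2.
have h : eprod (-1) 2 1 * eprod 1 2 1 = eprod (-1) 4 2 by rewrite eprod_conj.
have h2 : eprod (-1) 2 2 = eprod (-1) 4 2 * eprod (-1) 4 4 by rewrite eprod_split2.
by rewrite /P [eprod (-1) 1 1]eprod_split2 // [X in _ = X](_ : _ =
  eprod (-1) 2 1 * eprod (-1) 2 2 *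
  ((eprod (-1) 2 1 * eprod 1 2 1) * eprod (-1) 4 4)); [rewrite h -h2 | ring].
Qed.

Lemma Omega_Afq : Omega * Afq = V P.
Proof.
have -> : Omega = eprod (-1) 6 1 * eprod (-1) 6 5 * eprod (-1) 6 6.
  by apply/esym/(@jacobi_triple_product (-1) 6 1); rewrite // mulrNN mulr1.
have -> : Afq = eprod 1 3 1 * eprod 1 3 2 * eprod (-1) 3 3.
  by apply/esym/(@jacobi_triple_product 1 3 1); rewrite // mulr1.
rewrite VM !V_eprod ?VN1 //.
have h1 : eprod (-1) 3 1 = eprod (-1) 6 1 * eprod (-1) 6 4 by rewrite eprod_split2.
have h2 : eprod (-1) 3 2 = eprod (-1) 6 2 * eprod (-1) 6 5 by rewrite eprod_split2.
have h3 : eprod (-1) 3 1 * eprod 1 3 1 = eprod (-1) 6 2 by rewrite eprod_conj.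
have h4 : eprod (-1) 3 2 * eprod 1 3 2 = eprod (-1) 6 4 by rewrite eprod_conj.
(* The auxiliary factors complete the products of [Omega] to modulus 3, where they pair with those
   of [Afq] by [eprod_conj]. *)
apply: (@fps_cancel (eprod (-1) 6 2)); first exact: eprod_coef0.
apply: (@fps_cancel (eprod (-1) 6 4)); first exact: eprod_coef0.
transitivity ((eprod (-1) 3 1 * eprod 1 3 1) * (eprod (-1) 3 2 * eprod 1 3 2) *
              (eprod (-1) 3 3 * eprod (-1) 6 6)).
  by rewrite h1 h2; ring.
by rewrite h3 h4; ring.
Qed.

(** The product of the dissections of [phi] and [psi]; its middle component, before the outer [V],
    is P(q^3) - 2 P(q^3) by [Omega_Afq]. *)
Lemma P_dissection :
  P = V (V phi * Afq) + qx 1 * V (- V P) + qx 1 ^+ 2 * V (-2 * Omega * V psi).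
Proof.
have e : - V P = V phi * V psi - 2 * (Omega * Afq).
  by rewrite Omega_Afq {1 2}P_eq_phi_psi VM; ring.
rewrite e {1}P_eq_phi_psi {1}phi_dissection {1}psi_dissection.
by rewrite !(VM, VB, VD, VN, V1); ring.
Qed.

(** * The norm and the cubic equation *)

(* The norm from [Z[[q]]] to [Z[[q^3]]], read in the variable [q^3]. *)
Definition Nm (f : fps) : fps :=
  U 0 f ^+ 3 + qx 1 * U 1 f ^+ 3 + qx 1 ^+ 2 * U 2 f ^+ 3
  - 3 * qx 1 * U 0 f * U 1 f * U 2 f.

Lemma V_qx1 : V (qx 1) = qx 1 ^+ 3. Proof. by rewrite V_qx qxX. Qed.

Lemma Nm_dec a b c : Nm (V a + qx 1 * V b + qx 1 ^+ 2 * V c) =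
  a ^+ 3 + qx 1 * b ^+ 3 + qx 1 ^+ 2 * c ^+ 3 - 3 * qx 1 * a * b * c.
Proof. by have [h0 h1 h2] := U_dec a b c; rewrite /Nm h0 h1 h2. Qed.

Lemma Nm_M f g : Nm (f * g) = Nm f * Nm g.
Proof.
have -> : f * g =
    V (U 0 f * U 0 g + qx 1 * (U 1 f * U 2 g + U 2 f * U 1 g))
    + qx 1 * V (U 0 f * U 1 g + U 1 f * U 0 g + qx 1 * (U 2 f * U 2 g))
    + qx 1 ^+ 2 * V (U 0 f * U 2 g + U 1 f * U 1 g + U 2 f * U 0 g).
  by rewrite {1}(V_dec f) {1}(V_dec g) !(VD, VM) V_qx1; ring.
by rewrite Nm_dec /Nm; ring.
Qed.

Lemma U_eqm N s f g : (s < 3)%N -> eqm (3 * N) f g -> eqm N (U s f) (U s g).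
Proof. by move=> s3 e n nN; apply: e; lia. Qed.

Lemma eqmX N f g k : eqm N f g -> eqm N (f ^+ k) (g ^+ k).
Proof. by move=> e; elim: k => // k IH; rewrite !exprS; apply: eqmM. Qed.

Lemma Nm_eqm N f g : eqm (3 * N) f g -> eqm N (Nm f) (Nm g).
Proof.
move=> e; have h s : (s < 3)%N -> eqm N (U s f) (U s g) by move=> s3; apply: U_eqm.
by rewrite /Nm; repeat first [apply: h; done | apply: eqmX
  | apply: eqmD | apply: eqmN | apply: eqmM | exact: eqm_refl].
Qed.

Lemma Nm_V f : Nm (V f) = f ^+ 3.
Proof.
rewrite -[V f]addr0 -[X in _ + X](mulr0 (qx 1 ^+ 2)) -[V f]addr0.
rewrite -[X in V f + X](mulr0 (qx 1)) -(raddf0 V) Nm_dec; ring.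
Qed.

Lemma Nm_dprod u : tame u -> (forall k, Nm (u k) = u k) -> Nm (dprod u) = dprod u.
Proof.
(* [Nm] divides the precision by 3, so 3N factors are compared modulo q^N. *)
move=> tu Nu; apply: eqm_dprod => // N; exists (3 * N)%N; first by lia.
have -> : \prod_(k < 3 * N) u k = Nm (\prod_(k < 3 * N) u k).
  apply: (big_ind (fun f => f = Nm f)) => [|x y hx hy|k _]; last by rewrite Nu.
    by rewrite -V1 Nm_V expr1n V1.
  by rewrite Nm_M -hx -hy.
by apply: Nm_eqm; apply: dprod_eqm.
Qed.

(** For a primitive cube root of unity z, the conjugates 1 - z^(jm) q^m multiply to 1 - q^(3m),
    since m is prime to 3. *)
Lemma Nm_binomial m : ~~ (3 %| m)%N -> Nm (1 + -1 * qx m) = 1 + -1 * qx m.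
Proof.
move=> m3; have [k [->|->]] : exists k, (m = 3 * k + 1 \/ m = 3 * k + 2)%N.
- by exists (m %/ 3)%N; lia.
- have e : 1 + -1 * qx (3 * k + 1) = V 1 + qx 1 * V (- qx k) + qx 1 ^+ 2 * V 0.
    by rewrite VN V_qx raddf0 V1 qxD; ring.
  by rewrite {1}e Nm_dec -[(3 * k)%N]mulnC qxD -qxX; ring.
- have e : 1 + -1 * qx (3 * k + 2) = V 1 + qx 1 * V 0 + qx 1 ^+ 2 * V (- qx k).
    by rewrite VN V_qx raddf0 V1 qxD -(qxX 1 2); ring.
  by rewrite {1}e Nm_dec -[(3 * k)%N]mulnC qxD -qxX -(qxX 1 2); ring.
Qed.

Lemma Nm_eprod c r : (0 < c)%N -> (3 %| c)%N -> ~~ (3 %| r)%N ->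
  Nm (eprod (-1) c r) = eprod (-1) c r.
Proof.
move=> c0 c3 r3; have r0 : (0 < r)%N by case: r r3.
apply: Nm_dprod => [|k]; first exact: tame_eprod.
by apply: Nm_binomial; rewrite dvdn_addr // dvdn_mulr.
Qed.

(** Split E = [eprod (-1) c c] by the index modulo 3: the factors with exponent prime to 3 form E /
    [V E], fixed by the norm, and the rest is [V E], of norm E^3. *)
Lemma Nm_eprod_diag c : (0 < c)%N -> ~~ (3 %| c)%N ->
  Nm (eprod (-1) c c) * V (eprod (-1) c c) = eprod (-1) c c ^+ 4.
Proof.
move=> c0 c3; have e := eprod_split3 (-1) c0 c0.
have e3 : V (eprod (-1) c c) = eprod (-1) (3 * c) (2 * c + c).
  by rewrite V_eprod ?VN1 //; congr eprod; lia.
rewrite {1}e -e3 !Nm_M Nm_V !Nm_eprod; [|lia..].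
rewrite [X in _ = X]exprS [X in _ = X * _]e -e3; ring.
Qed.

Lemma Nm_P : Nm P * V P = P ^+ 4.
Proof.
by rewrite /P Nm_M VM exprMn -!Nm_eprod_diag //; ring.
Qed.

Lemma P_coef0 : P 0%N = 1.
Proof. by rewrite /P fpsM big_ord1 !eprod_coef0 // mulr1. Qed.

Lemma V_coef0 f : V f 0%N = f 0%N. Proof. by []. Qed.

(* The three conjugates of [w = P(q) / (q P(q^9))] are the roots of
   [w^3 + 3 w^2 + 9 w = P(q^3)^4 / (q^3 P(q^9)^4)]. *)
Lemma P_cubic :
  V P ^+ 4 = V (V P) * (P ^+ 3 + 3 * qx 1 * P ^+ 2 * V (V P)
                        + 9 * qx 1 ^+ 2 * P * V (V P) ^+ 2).
Proof.
set a := V phi * Afq; set c := -2 * Omega * V psi; set R := V P.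
have ac : a * c = -2 * R ^+ 2.
  by rewrite /R expr2 -{1}Omega_Afq {1}P_eq_phi_psi VM /a /c; ring.
have NP : Nm P = a ^+ 3 + qx 1 ^+ 2 * c ^+ 3 - 7 * qx 1 * R ^+ 3.
  rewrite P_dissection Nm_dec -/a -/c -/R.
  have -> : 3 * qx 1 * a * (- R) * c = 6 * qx 1 * R ^+ 3.
    by transitivity (- 3 * qx 1 * R * (a * c)); [ring | rewrite ac; ring].
  by ring.
have Vac : V a * V c = -2 * V R ^+ 2.
  by rewrite -VM ac VM VX VN rmorph_nat.
have PE : P = V a - qx 1 * V R + qx 1 ^+ 2 * V c by rewrite {1}P_dissection -/a -/c -/R VN; ring.
clearbody a c.
have -> : R ^+ 4 = V R * V (Nm P) by rewrite mulrC -VM Nm_P VX.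
congr (_ * _).
rewrite NP VB VD !(VX, VM) V_qx1 rmorph_nat.
(* Only the sum and the product of [V a] and q^2 [V c] enter. The sum is P + q [V R] and the product
   is known, which eliminates a and c. *)
transitivity ((V a + qx 1 ^+ 2 * V c) ^+ 3 - 7 * qx 1 ^+ 3 * V R ^+ 3
   - 3 * qx 1 ^+ 2 * (V a * V c) * (V a + qx 1 ^+ 2 * V c)); first by ring.
have -> : V a + qx 1 ^+ 2 * V c = P + qx 1 * V R by rewrite {1}PE; ring.
by rewrite Vac; ring.
Qed.

(** * Extraction from the powers of F *)

Definition F : fps := Fgen.

Lemma fps0M (f g : fps) : f 0%N = 1 -> g 0%N = 1 -> (f * g) 0%N = 1.
Proof. by move=> f0 g0; rewrite fpsM big_ord1 f0 g0 mulr1. Qed.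

Lemma fps0X (f : fps) n : f 0%N = 1 -> (f ^+ n) 0%N = 1.
Proof. by move=> f0; elim: n => // n IH; rewrite exprS fps0M. Qed.

Lemma P_mul_F : P * F = V P.
Proof.
have -> : F = V P * (sinv P : fps).
  rewrite /F /Fgen /P !fq_eprod // VM !V_eprod ?VN1 //.
by rewrite mulrCA sinvP ?mulr1 // P_coef0.
Qed.

Lemma F_coef0 : F 0%N = 1.
Proof.
have /fpsP/(_ 0%N) := P_mul_F.
by rewrite fpsM big_ord1 P_coef0 mul1r => ->; rewrite V_coef0 P_coef0.
Qed.

(** [P_cubic] rewritten by P F = [V P] and [V P] [V F] = [V (V P)], after which P^3 [V P]
    cancels. *)
Lemma F_cubic :
  F ^+ 3 = V F * (1 + 3 * qx 1 * F * V F + 9 * qx 1 ^+ 2 * F ^+ 2 * V F ^+ 2).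
Proof.
have VPF : V P * V F = V (V P) by rewrite -VM P_mul_F.
apply: (@fps_cancel (P ^+ 3 * V P)); first by rewrite fps0M ?fps0X ?V_coef0 ?P_coef0.
transitivity (V P * (P * F) ^+ 3); first by ring.
rewrite P_mul_F -exprS P_cubic -{1}VPF.
transitivity (V P * V F * (P ^+ 3 + 3 * qx 1 * P ^+ 2 * ((P * F) * V F) +
    9 * qx 1 ^+ 2 * P * ((P * F) * V F) ^+ 2)); first by rewrite P_mul_F VPF.
by ring.
Qed.

(** This is P(q)/P(q^3), so its components modulo 3 come from the dissection of P. *)
Definition G : fps := sinv F.

Lemma F_mul_G : F * G = 1. Proof. exact: sinvP F_coef0. Qed.

Lemma P_components :
  U 1 P = - V P /\ U 0 P * U 2 P = -2 * V P ^+ 2.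
Proof.
have := U_dec (V phi * Afq) (- V P) (-2 * Omega * V psi).
rewrite -P_dissection => -[-> -> ->]; split=> //.
by rewrite expr2 -{1}Omega_Afq {1}P_eq_phi_psi VM; ring.
Qed.

Lemma G_VP : G * V P = P.
Proof. by rewrite -P_mul_F mulrCA [G * F]mulrC F_mul_G mulr1. Qed.

Lemma U1G : U 1 G = - F.
Proof.
apply: (fps_cancel P_coef0); rewrite mulrC -U_mulV // G_VP P_components.1 -P_mul_F.
by rewrite mulrN.
Qed.

Lemma U2G2 : U 2 (G ^+ 2) = -3 * F ^+ 2.
Proof.
apply: (@fps_cancel (P ^+ 2)); first by rewrite fps0X ?P_coef0.
rewrite mulrC -U_mulV // VX -exprMn G_VP.
have [U1P U02P] := P_components.
have e : P ^+ 2 = V (U 0 P ^+ 2 + 2 * qx 1 * (U 1 P * U 2 P))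
    + qx 1 * V (2 * (U 0 P * U 1 P) + qx 1 * U 2 P ^+ 2)
    + qx 1 ^+ 2 * V (2 * (U 0 P * U 2 P) + U 1 P ^+ 2).
  by rewrite {1}(V_dec P) !VD !(VM, VX) V_qx1 !rmorph_nat; ring.
have [_ _ e2] := U_dec (U 0 P ^+ 2 + 2 * qx 1 * (U 1 P * U 2 P))
  (2 * (U 0 P * U 1 P) + qx 1 * U 2 P ^+ 2) (2 * (U 0 P * U 2 P) + U 1 P ^+ 2).
by rewrite {1}e e2 U02P U1P -P_mul_F; ring.
Qed.

Lemma U0_V f : U 0 (V f) = f. Proof. by rewrite UV. Qed.

Lemma Unat s k f : U s (k%:R * f) = k%:R * U s f.
Proof. by rewrite !mulr_natl UMn. Qed.

Definition Upow (i : nat) : fps := U 0 ((qx 1 * F) ^+ i).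

Lemma Upow1 : Upow 1 = 3 * qx 1 * F ^+ 3.
Proof.
rewrite /Upow expr1 U0_qx.
(* Writing F = G^2 F^3 and applying [F_cubic] leaves powers of G, with known components, times
   series in q^3. *)
have e : F = G ^+ 2 * V F + 3 * (qx 1 * (G * V (F ^+ 2)))
    + 9 * (qx 1 * (qx 1 * V (F ^+ 3))).
  transitivity ((F * G) ^+ 2 * F); first by rewrite F_mul_G expr1n mul1r.
  transitivity (G ^+ 2 * F ^+ 3); first by ring.
  rewrite !VX F_cubic.
  transitivity (G ^+ 2 * V F + 3 * (qx 1 * (G * (F * G) * V F ^+ 2))
    + 9 * (qx 1 * (qx 1 * (F * G) ^+ 2 * V F ^+ 3))); first by ring.
  by rewrite F_mul_G; ring.
by rewrite {1}e !UD !Unat !U_qx !U_mulV // U0_V U1G U2G2; ring.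
Qed.

Lemma Upow2 : Upow 2 = 2 * qx 1 * F ^+ 2 + 27 * qx 1 ^+ 2 * F ^+ 6.
Proof.
have -> : Upow 2 = qx 1 * U 1 (F ^+ 2).
  by rewrite /Upow exprMn expr2 -mulrA !U_qx.
have e : F ^+ 2 = G * V F + 3 * (qx 1 * V (F ^+ 2))
    + 9 * (qx 1 * ((qx 1 * F) * V (F ^+ 3))).
  transitivity ((F * G) * F ^+ 2); first by rewrite F_mul_G mul1r.
  transitivity (G * F ^+ 3); first by ring.
  rewrite !VX F_cubic.
  transitivity (G * V F + 3 * (qx 1 * (F * G) * V F ^+ 2)
    + 9 * (qx 1 * (qx 1 * (F * G) * F * V F ^+ 3))); first by ring.
  by rewrite F_mul_G; ring.
rewrite {1}e !UD !Unat !U_qx !U_mulV // U0_V U1G.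
have := Upow1; rewrite /Upow expr1 => ->; ring.
Qed.

(** [F_cubic] times q^3 (qF)^i: the coefficients are series in q^3 and pass through [U 0]. *)
Lemma Upow_rec i : Upow i.+3 =
  qx 1 * F * Upow i + 3 * (qx 1 * F ^+ 2 * Upow i.+1) + 9 * (qx 1 * F ^+ 3 * Upow i.+2).
Proof.
rewrite /Upow.
have -> : (qx 1 * F) ^+ i.+3 = (qx 1 * F) ^+ i * V (qx 1 * F)
    + 3 * ((qx 1 * F) ^+ i.+1 * V (qx 1 * F ^+ 2))
    + 9 * ((qx 1 * F) ^+ i.+2 * V (qx 1 * F ^+ 3)).
  have := F_cubic; move: F => f ef.
  rewrite -addn3 exprD [(qx 1 * f) ^+ 3]exprMn !(VX, VM) ef V_qx1 !exprS; ring.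
by rewrite !UD !Unat !U_mulV //; ring.
Qed.

(** * The integers m_{i,j} as coefficients in powers of t = q F^4 *)

Lemma mmE i j : mm i.+4 j.+2 = if (i.+4 < j.+2)%N then 0
  else 9 * mm i.+3 j.+1 + 3 * mm i.+2 j.+1 + mm i.+1 j.+1.
Proof. by []. Qed.

(** Each step of the recurrence lowers j by one and i by one to three, so nonzero entries satisfy j
    <= i <= 3j. *)
Lemma mm_support i j : ((i < j) || (3 * j < i))%N -> mm i j = 0.
Proof.
have [m im] := ubnP i; elim: m i im j => // m IH i im j.
case: i im => [|[|[|[|i]]]] im; [by []|by case: j => [|[|j]]|
  by case: j => [|[|[|j]]] |by case: j => [|[|[|[|j]]]]|].
case: j => [|[|j]] // hij; rewrite mmE; case: ifP => // hn.
by rewrite !IH ?mulr0 //; lia.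
Qed.

Lemma mm_rec i j :
  mm i.+4 j.+2 = 9 * mm i.+3 j.+1 + 3 * mm i.+2 j.+1 + mm i.+1 j.+1.
Proof.
rewrite mmE; case: ifP => // ij.
by rewrite !(mm_support (j := j.+1)) ?mulr0 //; lia.
Qed.

Lemma mmn0 i : mm i 0 = 0. Proof. by case: i => [|[|[|[|i]]]]. Qed.

Definition t : fps := qx 1 * F ^+ 4.

(** The generating polynomial of row i; it is complete once N > i, and a free N lets several rows
    share one range. *)
Definition mmpoly (N i : nat) : fps := \sum_(j < N) (mm i j)%:~R * t ^+ j.

Lemma mmpoly_widen N M i : (i < N)%N -> (N <= M)%N -> mmpoly M i = mmpoly N i.
Proof.
move=> iN NM; rewrite /mmpoly -!(big_mkord xpredT (fun j => (mm i j)%:~R * t ^+ j)).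
rewrite (@big_cat_nat _ _ _ N 0 M) //= [X in _ + X]big1_seq ?addr0 // => j.
rewrite mem_index_iota => /andP[_ /andP[Nj _]].
by rewrite mm_support ?mul0r // (leq_trans iN Nj).
Qed.

Lemma mmpoly_rec N i : (i.+4 < N)%N ->
  mmpoly N i.+4 = t * (mmpoly N i.+1 + 3 * mmpoly N i.+2 + 9 * mmpoly N i.+3).
Proof.
move=> iN; have [M eN] : exists M, N = M.+2 by exists N.-2; lia.
(* Column 0 is zero and column M + 1 lies above the diagonal for these rows, so both ends of the sum
   drop out. *)
subst N; have sh k : (k <= i.+3)%N ->
    mmpoly M.+2 k = \sum_(j < M) (mm k j.+1)%:~R * t ^+ j.+1.
  move=> ki; rewrite (mmpoly_widen (N := M.+1)) //; last by lia.
  by rewrite /mmpoly big_ord_recl mmn0 mul0r add0r.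
rewrite (sh i.+1) ?(sh i.+2) ?(sh i.+3) //; [|lia..].
rewrite /mmpoly; have m1 : mm i.+4 1 = 0 by [].
move: m1 (mm_rec i) mmn0; clear sh; move: mm => m m1 mE m0.
rewrite !big_ord_recl !m0 (_ : lift ord0 ord0 = 1%N :> nat) // m1 /=.
rewrite !mul0r !add0r !mulr_sumr -!big_split mulr_sumr.
apply: eq_bigr => j _; rewrite /bump /= ?add1n mE.
by rewrite !rmorphD !rmorphM [t ^+ j.+2]exprS !rmorph_nat; ring.
Qed.

(** Both sides satisfy the same recurrence of order three and agree for i = 1, 2, 3. *)
Lemma Upow_mmpoly N i : (0 < i)%N -> (i < N)%N -> F ^+ i * Upow i = mmpoly N i.
Proof.
have Upow3 : Upow 3 = qx 1 * F + 27 * qx 1 ^+ 2 * F ^+ 5 + 243 * qx 1 ^+ 3 * F ^+ 9.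
  rewrite Upow_rec Upow1 Upow2 {1}/Upow expr0 -V1 U0_V V1; ring.
have [m im] := ubnP i; elim: m i im N => // m IH i im N.
case: i im => [|[|[|[|i]]]] im // _ iN.
- rewrite (mmpoly_widen (N := 2)) // /mmpoly !big_ord_recl big_ord0 /= Upow1 /t; ring.
- rewrite (mmpoly_widen (N := 3)) // /mmpoly !big_ord_recl big_ord0 /= Upow2 /t; ring.
- rewrite (mmpoly_widen (N := 4)) // /mmpoly !big_ord_recl big_ord0 /= Upow3 /t; ring.
rewrite mmpoly_rec // -!IH; [|lia..].
rewrite Upow_rec /t !exprS; ring.
Qed.

(** Columns below n/3 vanish in row n, so t^d can be split off. *)
Lemma Upow_mmpoly_shifted n d N : (0 < n)%N -> (3 * d < n + 3)%N -> (n < d + N)%N ->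
  F ^+ n * Upow n = \sum_(j < N) (mm n (d + j))%:~R * t ^+ (d + j).
Proof.
move=> n0 dn nN; rewrite (Upow_mmpoly n0 nN) /mmpoly big_split_ord /= big1 ?add0r // => k _.
by rewrite mm_support ?mul0r //; apply/orP; right; have := ltn_ord k; lia.
Qed.

(** * The vectors x_alpha and the passage between progressions *)

Definition Fterm (e i : nat) : fps := qx i * F ^+ (4 * i + e).

(** As e + e' = 4, t^(i+1+j) is q^(i+1) F^(4i+e) times q^j F^(4j+e'). Dividing by the first factor
    exchanges the exponent classes 1 and 3 modulo 4. *)
Lemma Fterm_of_Upow e e' i N (u : fps) : (0 < e)%N -> (e + e' = 4)%N ->
  (3 * i + e <= N)%N -> qx i.+1 * u = Upow (4 * i + e) ->
  u = \sum_(j < N) (mm (4 * i + e) (i.+1 + j))%:~R * Fterm e' j.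
Proof.
move=> e0 ee iN hu; apply: (@qx_inj i.+1).
apply: (@fps_cancel (F ^+ (4 * i + e))); first by rewrite fps0X // F_coef0.
rewrite hu (@Upow_mmpoly_shifted _ i.+1 N); [|lia..].
rewrite !mulr_sumr; apply: eq_bigr => j _.
suff -> : t ^+ (i.+1 + j) = F ^+ (4 * i + e) * (qx i.+1 * Fterm e' j) by ring.
rewrite /Fterm /t exprMn qxX -exprM mul1n qxD.
have -> : (4 * (i.+1 + j) = 4 * i + e + (4 * j + e'))%N by lia.
by rewrite (exprD _ (4 * i + e)); ring.
Qed.

Lemma U2_Fterm1 i N : (3 * i + 1 <= N)%N ->
  U 2 (Fterm 1 i) = \sum_(j < N) (Amat i.+1 j.+1)%:~R * Fterm 3 j.
Proof.
move=> iN; rewrite (@Fterm_of_Upow 1 3 i N (U 2 (Fterm 1 i))) //.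
  apply: eq_bigr => j _; congr ((mm _ _)%:~R * _); lia.
rewrite /Upow exprMn qxX mul1n.
(* Of the 4i+1 factors q, one turns [U 0] into [U 2], i belong to [Fterm 1 i], and 3i leave the
   extraction as q^i. *)
have -> : (4 * i + 1 = 1 + (i + 3 * i))%N by lia.
rewrite [qx (1 + _)]qxD [qx (i + _)]qxD -[qx (3 * i)]V_qx.
transitivity (U 0 (qx 1 * Fterm 1 i * V (qx i))).
  by rewrite U_mulV // U0_qx -add1n qxD; ring.
congr U; rewrite /Fterm; have -> : (4 * i + 1 = 1 + (i + 3 * i))%N by lia.
by ring.
Qed.

Lemma U0_Fterm3 i N : (3 * i + 3 <= N)%N ->
  U 0 (Fterm 3 i) = \sum_(j < N) (Bmat i.+1 j.+1)%:~R * Fterm 1 j.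
Proof.
move=> iN; rewrite (@Fterm_of_Upow 3 1 i N (U 0 (Fterm 3 i))) //.
  apply: eq_bigr => j _; congr ((mm _ _)%:~R * _); lia.
rewrite mulrC -U_mulV // V_qx /Upow exprMn qxX mul1n /Fterm; congr U.
have -> : (4 * i + 3 = i + 3 * i.+1)%N by lia.
by rewrite qxD; ring.
Qed.

Definition expo (b : nat) : nat := if odd b then 3 else 1.

Definition Fsum (b : nat) : fps :=
  \sum_(i < 3 ^ b) (xv b i.+1)%:~R * Fterm (expo b) i.

Lemma xvS b j : xv b.+1 j =
  \sum_(i < 3 ^ b) xv b i.+1 * (if odd b then Bmat i.+1 j else Amat i.+1 j).
Proof. by rewrite /= big_add1 big_mkord. Qed.

Lemma xv_support b j : (3 ^ b < j)%N -> xv b j = 0.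
Proof.
case: b => [|b]; first by case: j => [|[|j]].
rewrite expnS => jb; rewrite xvS big1 // => i _; have := ltn_ord i => ib.
by case: ifP => _; rewrite ?/Amat ?/Bmat mm_support ?mulr0 //; lia.
Qed.

Lemma U_int s (x : int) f : (s < 3)%N -> U s (x%:~R * f) = x%:~R * U s f.
Proof.
by move=> s3; rewrite mulrC -[x%:~R in LHS](rmorph_int V) U_mulV // mulrC.
Qed.

Lemma U_sum s I (r : seq I) (u : I -> fps) :
  U s (\sum_(i <- r) u i) = \sum_(i <- r) U s (u i).
Proof. by elim: r => [|i r IH]; rewrite ?big_nil // !big_cons UD IH. Qed.

(** Each term expands along a row of A or B, and exchanging the sums forms the vector-matrix
    product. The inner range 3^(b+1) is at least 3i+3 for every i < 3^b. *)
Lemma Fsum_step b : U (if odd b then 0 else 2) (Fsum b) = Fsum b.+1.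
Proof.
have s3 : ((if odd b then 0 else 2) < 3)%N by case: ifP.
rewrite /Fsum U_sum.
transitivity (\sum_(i < 3 ^ b) \sum_(j < 3 ^ b.+1) ((xv b i.+1 *
    (if odd b then Bmat i.+1 j.+1 else Amat i.+1 j.+1))%:~R * Fterm (expo b.+1) j)).
  apply: eq_bigr => i _; rewrite U_int //; have ib := ltn_ord i.
  rewrite /expo /=; case: (odd b) => /=.
    rewrite (@U0_Fterm3 i (3 ^ b.+1)) ?expnS; last by lia.
    by rewrite mulr_sumr; apply: eq_bigr => j _; rewrite rmorphM mulrA.
  rewrite (@U2_Fterm1 i (3 ^ b.+1)) ?expnS; last by lia.
  by rewrite mulr_sumr; apply: eq_bigr => j _; rewrite rmorphM mulrA.
rewrite exchange_big; apply: eq_bigr => j _.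
by rewrite xvS rmorph_sum mulr_suml.
Qed.

Lemma fpsMz (x : int) (f : fps) n : (x%:~R * f) n = x * f n.
Proof.
have hn (k : nat) (g : fps) : (k%:R * g) n = k%:R * g n.
  by rewrite !mulr_natl fpsMn.
case: x => k; first by rewrite -pmulrn hn natz.
by rewrite NegzE mulrNz -pmulrn !mulNr fpsN hn natz.
Qed.

Lemma sexpE (f : fps) e : sexp f e = f ^+ e.
Proof. by elim: e => // e IH; rewrite exprS -IH. Qed.

Lemma Fsum_coef b n :
  Fsum b n = \sum_(i < n.+1) xv b i.+1 * sexp Fgen (4 * i + expo b) (n - i)%N.
Proof.
pose f i := xv b i.+1 * (Fterm (expo b) i) n.
have -> : Fsum b n = \sum_(0 <= i < 3 ^ b) f i.
  by rewrite /Fsum fps_sum big_mkord; apply: eq_bigr => i _; rewrite fpsMz.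
have -> : \sum_(i < n.+1) xv b i.+1 * sexp Fgen (4 * i + expo b) (n - i)%N
   = \sum_(0 <= i < n.+1) f i.
  rewrite big_mkord; apply: eq_bigr => i _.
  by rewrite /f /Fterm qxM -ltnS ltn_ord (sexpE F).
(* Both ranges extend to 3^b + n + 1: the entries of x vanish from 3^b on, and q^i kills coefficient
   n for i > n. *)
have ext m M : (m <= M)%N -> (forall i, (m <= i)%N -> f i = 0) ->
   \sum_(0 <= i < M) f i = \sum_(0 <= i < m) f i.
  move=> mM f0; rewrite (@big_cat_nat _ _ _ m) //= [X in _ + X]big1_seq ?addr0 // => i.
  by rewrite mem_index_iota => /andP[_ /andP[mi _]]; apply: f0.
rewrite -(ext _ (3 ^ b + n.+1)%N (leq_addr _ _)) => [|i bi].
  apply: ext => [|i ni]; first exact: leq_addl.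
  by rewrite /f /Fterm qxM leqNgt ni mulr0.
by rewrite /f xv_support ?mul0r.
Qed.

Lemma a3_Fsum alpha :
  (forall n, a3 (3 ^ (2 * alpha) * n + (3 ^ (2 * alpha) - 1) %/ 4)%N
     = Fsum (2 * alpha) n) /\
  (forall n, a3 (3 ^ (2 * alpha + 1) * n + (3 ^ (2 * alpha + 2) - 1) %/ 4)%N
     = Fsum (2 * alpha + 1) n).
Proof.
have odd2 a : odd (2 * a) = false by rewrite oddM.
(* The divisions by 4 in the offsets are exact. *)
have mod4 a : exists k, (3 ^ (2 * a) = 4 * k + 1)%N.
  elim: a => [|a [k IH]]; first by exists 0%N.
  by exists (9 * k + 2)%N; rewrite mulnS expnD IH; lia.
(* Replacing n by 3n+2 works because 2 * 9^a + (9^a - 1)/4 = (9^(a+1) - 1)/4. *)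
have step1 a : (forall n, a3 (3 ^ (2 * a) * n + (3 ^ (2 * a) - 1) %/ 4)%N = Fsum (2 * a) n) ->
  forall n, a3 (3 ^ (2 * a + 1) * n + (3 ^ (2 * a + 2) - 1) %/ 4)%N = Fsum (2 * a + 1) n.
  move=> IH n; rewrite [(2 * a + 1)%N]addn1 -Fsum_step odd2 /U -IH; congr a3.
  by have [k ek] := mod4 a; rewrite expnD expnS ek; lia.
elim: alpha => [|a [_ IH]].
  have h0 n : a3 (3 ^ (2 * 0) * n + (3 ^ (2 * 0) - 1) %/ 4)%N = Fsum (2 * 0) n.
    rewrite muln0 expn0 mul1n addn0 /Fsum big_ord1 fpsMz mul1r /Fterm muln0 expr1.
    by rewrite qx0 mul1r.
  by split=> //; apply: step1.
(* Replacing n by 3n keeps the offset. *)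
have h0 n : a3 (3 ^ (2 * a.+1) * n + (3 ^ (2 * a.+1) - 1) %/ 4)%N = Fsum (2 * a.+1) n.
  have -> : (2 * a.+1 = (2 * a + 1).+1)%N by lia.
  rewrite -Fsum_step oddD odd2 /U -IH; congr a3.
  by congr (_ + (3 ^ _ - 1) %/ 4)%N; [rewrite expnS addn0; lia | lia].
by split=> //; apply: step1.
Qed.

(* coefficient of q^n of sum_{i>=1} x_i q^{i-1} F^{4i-3} is
   sum_{0 <= i' <= n} x_{i'+1} [q^{n-i'}] F^{4i'+1}  (i = i'+1) *)
Theorem theorem3p1 (alpha : nat) :
  (forall n : nat,
    a3 (3 ^ (2 * alpha) * n + (3 ^ (2 * alpha) - 1) %/ 4)%N =
    \sum_(i < n.+1) xv (2 * alpha) i.+1 * sexp Fgen (4 * i.+1 - 3) (n - i)%N) /\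
  (forall n : nat,
    a3 (3 ^ (2 * alpha + 1) * n + (3 ^ (2 * alpha + 2) - 1) %/ 4)%N =
    \sum_(i < n.+1) xv (2 * alpha + 1) i.+1 * sexp Fgen (4 * i.+1 - 1) (n - i)%N).
Proof.
have [h0 h1] := a3_Fsum alpha.
have odd2 : odd (2 * alpha) = false by rewrite oddM.
split=> n; rewrite (h0, h1) Fsum_coef /expo ?addn1 /= odd2 /=;
  by apply: eq_bigr => i _; congr (_ * sexp _ _ _); lia.
Qed.
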